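(* Let $b\ge2$ and $N\ge0$ be integers, and let $\{s_n(x)\}$ be a Sheffer polynomial sequence with associated sequence $\{p_n(x)\}$. With the matrices $S_{b,N}$, $P_{b,N}$ defined below, for $\mathbf{x}_N=(x_0,\dots,x_{N-1})$, $\mathbf{y}_N=(y_0,\dots,y_{N-1})$ and $\mathbf{x}_N+\mathbf{y}_N=(x_0+y_0,\dots,x_{N-1}+y_{N-1})$, \[ P_{b,N}(\mathbf{x}_N)S_{b,N}(\mathbf{y}_N)=S_{b,N}(\mathbf{x}_N+\mathbf{y}_N)\quad\text{and}\quad P_{b,N}(\mathbf{x}_N)P_{b,N}(\mathbf{y}_N)=P_{b,N}(\mathbf{x}_N+\mathbf{y}_N). \]
   Context: Sheffer sequences: let $f(t)=\sum_{k\ge0}a_kt^k$ with $a_0=0,a_1\ne0$, $g(t)=\sum_{k\ge0}b_kt^k$ with $b_0\ne0$, $\bar f$ the compositional inverse of $f$; $s_n(x)$ is defined by $\frac{1}{g(\bar f(t))}e^{x\bar f(t)}=\sum_{n\ge0}\frac{s_n(x)}{n!}t^n$ and its associated sequence $p_n(x)$ by $e^{x\bar f(t)}=\sum_{n\ge0}\frac{p_n(x)}{n!}t^n$. Put $\bar s_k=s_k/k!$, $\bar p_k=p_k/k!$. For non-negative integers $k,j$, $k\preceq_b j$ means every base-$b$ digit of $k$ is at most the corresponding digit of $j$. Set $S_{b,0}=P_{b,0}=1$ (the $1\times1$ matrix). For $N>0$, $S_{b,N}(\mathbf{x}_N)$ and $P_{b,N}(\mathbf{x}_N)$ are the $b^N\times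 b^N$ matrices with rows and columns indexed by $0,\dots,b^N-1$, whose $(j,k)$ entries are respectively $\prod_{i=0}^{N-1}\bar s_{d_i}(x_i)$ and $\prod_{i=0}^{N-1}\bar p_{d_i}(x_i)$ if $0\le k\le j\le b^N-1$ and $k\preceq_b j$, and $0$ otherwise, where $j-k=d_0b^0+\cdots+d_{N-1}b^{N-1}$ is the base-$b$ expansion of $j-k$. *)

(* Defs.v *)
From HB Require Import structures.
From mathcomp Require Import all_boot all_order all_algebra.
Set Implicit Arguments.
Unset Strict Implicit.
Unset Printing Implicit Defensive.
Import GRing.Theory.
Local Open Scope ring_scope.

(* A formal power series is its sequence of coefficients; equality of series
   is always stated pointwise, with [=1]. *)
Definition fps (R : Type) := nat -> R.

Section FormalPowerSeries.
Variable R : comNzRingType.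
Implicit Types u v : fps R.

Definition fps_one : fps R := fun n => (n == 0%N)%:R.
Definition fps_t : fps R := fun n => (n == 1%N)%:R.

Definition fps_mul u v : fps R := fun n => \sum_(i < n.+1) u i * v (n - i)%N.

Definition fps_pow u (k : nat) : fps R := iter k (fps_mul u) fps_one.

(* u(v(t)), for v without constant term: [fps_pow v k n] then vanishes
   for k > n, so the infinite sum over k stops at n. *)
Definition fps_comp u v : fps R :=
  fun n => \sum_(k < n.+1) u k * fps_pow v k n.

Definition fps_compinv u v : Prop :=
  [/\ u 0%N = 0, v 0%N = 0, fps_comp u v =1 fps_t & fps_comp v u =1 fps_t].

End FormalPowerSeries.

Arguments fps_one {R}.
Arguments fps_t {R}.

Section Reciprocal.
Variable K : fieldType.
Implicit Type u : fps K.

(* The first n coefficients of 1/u(t), from the recursion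
   u_0 r_m + \sum_(i < m) r_i u_(m-i) = [m = 0]. *)
Fixpoint fps_inv_seq u (n : nat) : seq K :=
  if n is m.+1 then
    let r := fps_inv_seq u m in
    rcons r (((m == 0%N)%:R - \sum_(i < m) r`_i * u (m - i)%N) / u 0%N)
  else [::].

Definition fps_inv u : fps K := fun n => (fps_inv_seq u n.+1)`_n.

Lemma size_fps_inv_seq u n : size (fps_inv_seq u n) = n.
Proof. by elim: n => //= n IHn; rewrite size_rcons IHn. Qed.

Lemma nth_fps_inv_seq u n i : (i < n)%N -> (fps_inv_seq u n)`_i = fps_inv u i.
Proof.
elim: n => // n IHn; rewrite ltnS leq_eqVlt => /predU1P[-> //|lt_in] /=.
by rewrite nth_rcons size_fps_inv_seq lt_in IHn.
Qed.

Lemma fps_mulVf u : u 0%N != 0 -> fps_mul (fps_inv u) u =1 fps_one.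
Proof.
move=> u0 n; rewrite /fps_mul big_ord_recr /= subnn {2}/fps_inv /=.
rewrite nth_rcons size_fps_inv_seq ltnn eqxx divfK //.
rewrite -[RHS](subrK (\sum_(i < n) (fps_inv_seq u n)`_i * u (n - i)%N)) addrC.
by congr (_ + _); apply: eq_bigr => i _; rewrite nth_fps_inv_seq.
Qed.

End Reciprocal.

Section Sheffer.
Variable K : fieldType.

(* e^(x h(t)), for h without constant term, as a power series in t with
   coefficients in K[x]; x is the polynomial indeterminate. *)
Definition exp_gf (h : fps K) : fps {poly K} :=
  fps_comp (fun k => (k`!%:R^-1)%:P) (fun n => h n *: 'X).

Definition divfact (s : nat -> {poly K}) (k : nat) : {poly K} :=
  k`!%:R^-1 *: s k.

Definition sheffer_seq (g fbar : fps K) (s : nat -> {poly K}) : Prop :=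
  fps_mul (fun n => (fps_inv (fps_comp g fbar) n)%:P) (exp_gf fbar)
    =1 divfact s.

Definition associated_seq (fbar : fps K) (p : nat -> {poly K}) : Prop :=
  exp_gf fbar =1 divfact p.

End Sheffer.

Section Digits.
Local Open Scope nat_scope.

Definition digit (b i n : nat) : nat := (n %/ b ^ i) %% b.

(* Digits of k at positions i >= k vanish, since k < b ^ k when b >= 2; see
   [digit_leP]. *)
Definition digit_le (b k j : nat) : bool :=
  [forall i : 'I_k, digit b i k <= digit b i j].

Lemma digit_leP b k j : 1 < b ->
  reflect (forall i, digit b i k <= digit b i j) (digit_le b k j).
Proof.
move=> b_gt1; apply: (iffP forallP) => [le_kj i | le_kj i]; last exact: le_kj.
have [lt_ik | le_ki] := ltnP i k; first exact: (le_kj (Ordinal lt_ik)).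
by rewrite /digit divn_small ?mod0n // (leq_trans (ltn_expl k b_gt1)) ?leq_exp2l.
Qed.

End Digits.

Section DigitMatrix.
Variable K : fieldType.

(* S_{b,N}(x) for the sequence s, and P_{b,N}(x) for the associated sequence.
   At N = 0 the formula gives the 1 x 1 identity; see [digit_mx0]. *)
Definition digit_mx (s : nat -> {poly K}) (b N : nat) (x : 'rV[K]_N) :
    'M[K]_(b ^ N) :=
  \matrix_(j, k)
    if (k <= j)%N && digit_le b k j
    then \prod_(i < N) (divfact s (digit b i (j - k))).[x 0 i]
    else 0.

Lemma digit_mx0 (s : nat -> {poly K}) (b : nat) (x : 'rV[K]_0) :
  digit_mx s b x = 1%:M.
Proof.
have ord_eq0 (i : 'I_(b ^ 0)) : i = 0%N :> nat by case: i => [[|i]].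
apply/matrixP=> j k; have -> : k = j by apply: val_inj; rewrite /= !ord_eq0.
rewrite !mxE eqxx leqnn big_ord0 ifT //.
by apply/forallP=> i; have := ltn_ord i; rewrite [X in (_ < X)%N]ord_eq0.
Qed.

End DigitMatrix.

(* Main.v *)
Require Import Defs.
From HB Require Import structures.
From mathcomp Require Import all_boot all_order all_algebra.
From mathcomp Require Import zify ring.
Set Implicit Arguments.
Unset Strict Implicit.
Unset Printing Implicit Defensive.
Import GRing.Theory.
Local Open Scope ring_scope.

(** Since [k] is digitwise below [j] exactly when [j - k] is computed without
    borrows, each entry of [digit_mx] is a product over the digit positions of
    entries of lower triangular Toeplitz matrices.  Numbers below [b ^ N] are
    the digit vectors of length [N], so the product of two such matrices is
    computed position by position, where it is a convolution; there the claim
    is the binomial identity for the coefficients of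
    [e^(x h) * (r e^(y h)) = r e^((x + y) h)]. *)

(** * Power series arithmetic through polynomial truncation *)

Section PowerSeries.
Variable R : comNzRingType.
Implicit Types (u v w h : fps R) (m n k l : nat).

(** Each coefficient of a product or power depends on finitely many coefficients, so truncations
    carry the ring laws of [{poly R}] over to series. *)
Definition fps_trunc m u : {poly R} := \poly_(i < m.+1) u i.

Lemma coef_fps_trunc m u i : (i <= m)%N -> (fps_trunc m u)`_i = u i.
Proof. by move=> le_im; rewrite coef_poly ltnS le_im. Qed.

Lemma coef_mul_fps m u v (p q : {poly R}) :
    (forall i, (i <= m)%N -> p`_i = u i) ->
    (forall i, (i <= m)%N -> q`_i = v i) ->
  forall i, (i <= m)%N -> (p * q)`_i = fps_mul u v i.
Proof.
move=> pu qv n le_nm; rewrite coefM; apply: eq_bigr => -[i] /=; rewrite ltnS.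
by move=> le_in _; rewrite pu ?qv // ?(leq_trans _ le_nm) // leq_subr.
Qed.

Lemma coef_exp_fps m u (p : {poly R}) k :
    (forall i, (i <= m)%N -> p`_i = u i) ->
  forall i, (i <= m)%N -> (p ^+ k)`_i = fps_pow u k i.
Proof.
move=> pu; elim: k => [|k IHk] i le_im; first by rewrite coef1.
by rewrite exprS (coef_mul_fps pu IHk).
Qed.

Lemma fps_mulCA u v w :
  fps_mul u (fps_mul v w) =1 fps_mul v (fps_mul u w).
Proof.
move=> n; have T z := coef_fps_trunc (m := n) z.
rewrite -(coef_mul_fps (T u) (coef_mul_fps (T v) (T w)) (leqnn n)).
rewrite -(coef_mul_fps (T v) (coef_mul_fps (T u) (T w)) (leqnn n)).
by rewrite mulrCA.
Qed.

Lemma fps_powD u k l :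
  fps_pow u (k + l) =1 fps_mul (fps_pow u k) (fps_pow u l).
Proof.
move=> n; have T := coef_exp_fps _ (coef_fps_trunc (m := n) u).
by rewrite -T // exprD (coef_mul_fps (T k) (T l)).
Qed.

(** [h] is divisible by t, hence its [k]-th power by t^k. *)
Lemma fps_pow_small h k n : h 0%N = 0 -> (n < k)%N -> fps_pow h k n = 0.
Proof.
move=> h0; elim: k n => // k IHk n lt_nk /=.
rewrite /fps_mul big1 // => -[[|i] /= lt_in] _; first by rewrite h0 mul0r.
by rewrite -/(fps_pow h k) IHk ?mulr0 //; lia.
Qed.

End PowerSeries.

(** Summation along the antidiagonals [k + l = m]; the hypothesis removes the corner of the square
    beyond [k + l = n]. *)
Lemma sum_triangle (V : nmodType) (F : nat -> nat -> V) n :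
    (forall k l, (n < k + l)%N -> F k l = 0) ->
  \sum_(k < n.+1) \sum_(l < n.+1) F k l =
  \sum_(m < n.+1) \sum_(k < m.+1) F k (m - k)%N.
Proof.
move=> F0.
have inner (m : 'I_n.+1) : \sum_(k < m.+1) F k (m - k)%N =
    \sum_(k < n.+1 | (k <= m)%N) F k (m - k)%N.
  by rewrite (big_ord_widen_cond n.+1 xpredT (fun k => F k (m - k)%N)).
rewrite (eq_bigr _ (fun m _ => inner m)).
rewrite [RHS](exchange_big_dep xpredT) //=; apply: eq_bigr => k _.
rewrite -(big_mkord xpredT (F k)).
rewrite -(big_mkord (fun m => (k <= m)%N) (fun m => F k (m - k)%N)).
have le_kn : (k <= n.+1)%N by exact: ltnW.
(* For fixed [k], the terms with [l > n - k] vanish by [F0]; the others match [m = l + k]. *)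
rewrite (big_cat_nat (n := (n.+1 - k)%N)) ?leq_subr //=.
rewrite [X in _ + X]big_nat_cond [X in _ + X]big1 ?addr0; last first.
  by move=> l /andP[/andP[le_l _] _]; rewrite F0 //; lia.
rewrite [RHS](big_cat_nat (n := k)) //=.
rewrite [X in _ = X + _]big_nat_cond [X in _ = X + _]big1 ?add0r; last first.
  by move=> m /andP[/andP[_ lt_mk]]; rewrite leqNgt lt_mk.
rewrite -[X in _ = \sum_(X <= _ < _ | _) _]add0n big_addn.
by rewrite [RHS]big_mkcond; apply: eq_big_nat => l _; rewrite leq_addl addnK.
Qed.

(** * Addition formulas for the generating functions *)

Section Sheffer.
Variable K : fieldType.
Hypothesis charK : [pchar K] =i pred0.
Implicit Types (h r : fps K) (x y : K).

Lemma horner_exp_gf h n x :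
  (exp_gf h n).[x] = \sum_(k < n.+1) k`!%:R^-1 * (fps_pow h k n * x ^+ k).
Proof.
have powZX k m : fps_pow (fun i => h i *: 'X) k m = fps_pow h k m *: 'X^k.
  elim: k m => [|k IHk] m /=.
    by rewrite /fps_one expr0 alg_polyC; case: eqP.
  rewrite /fps_mul scaler_suml; apply: eq_bigr => i _.
  by rewrite -/(fps_pow _ k) IHk -scalerAl -scalerAr scalerA exprS.
rewrite /exp_gf /fps_comp horner_sum; apply: eq_bigr => k _.
by rewrite powZX hornerM hornerC hornerZ hornerXn.
Qed.

(** Both sides expand to the double sum of [F k l]: the left by the binomial theorem, the right by
    [fps_powD]. Characteristic 0 makes the factorials invertible. *)
Lemma horner_exp_gfD h n x y : h 0%N = 0 ->
  (exp_gf h n).[x + y] =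
  fps_mul (fun i => (exp_gf h i).[x]) (fun i => (exp_gf h i).[y]) n.
Proof.
move=> h0.
have fact_neq0 m : m`!%:R != 0 :> K.
  by rewrite ((pcharf0P K).1 charK) -lt0n fact_gt0.
pose F k l : K := fps_pow h (k + l) n * (x ^+ k / k`!%:R * (y ^+ l / l`!%:R)).
(* A range independent of [i] allows the sums to be exchanged; the added terms vanish by
   [fps_pow_small]. *)
have wide i z : (i <= n)%N -> (exp_gf h i).[z] =
    \sum_(k < n.+1) fps_pow h k i * (z ^+ k / k`!%:R).
  move=> le_in; rewrite horner_exp_gf.
  rewrite (big_ord_widen n.+1 (fun k => k`!%:R^-1 * (fps_pow h k i * z ^+ k))) //.
  rewrite big_mkcond; apply: eq_bigr => k _; case: ltnP => lt_ik.
    by rewrite mulrC mulrA.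
  by rewrite fps_pow_small // mul0r.
transitivity (\sum_(k < n.+1) \sum_(l < n.+1) F k l).
  rewrite (sum_triangle (F := F)); last first.
    by move=> k l lt_n; rewrite /F fps_pow_small // mul0r.
  rewrite horner_exp_gf; apply: eq_bigr => m _.
  (* After the swap, the index in [exprDn] is the exponent of [x], as in [F]. *)
  rewrite [x + y]addrC exprDn !mulr_sumr; apply: eq_bigr => -[k /=].
  rewrite ltnS => le_km _; rewrite /F subnKC // -mulr_natr.
  have bin_neq0 : 'C(m, k)%:R != 0 :> K.
    by rewrite ((pcharf0P K).1 charK) -lt0n bin_gt0.
  rewrite -(bin_fact le_km) !natrM; field.
  by rewrite bin_neq0 !fact_neq0.
symmetry; rewrite /fps_mul.
under eq_bigr => i _.
  have le_in : (i <= n)%N by rewrite -ltnS.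
  rewrite !wide ?leq_subr // big_distrlr /=; over.
rewrite exchange_big; apply: eq_bigr => k _ /=.
rewrite exchange_big; apply: eq_bigr => l _ /=.
rewrite /F fps_powD mulr_suml; apply: eq_bigr => i _.
by rewrite mulrACA.
Qed.

(** The factor [r] is constant in the indeterminate, so it can be moved past the series at [x] onto
    the one at [y]. *)
Lemma horner_sheffer_gfD r h n x y : h 0%N = 0 ->
  (fps_mul (fun i => (r i)%:P) (exp_gf h) n).[x + y] =
  fps_mul (fun i => (exp_gf h i).[x])
          (fun i => (fps_mul (fun i => (r i)%:P) (exp_gf h) i).[y]) n.
Proof.
move=> h0.
have evalM m z : (fps_mul (fun i => (r i)%:P) (exp_gf h) m).[z] =
    fps_mul r (fun i => (exp_gf h i).[z]) m.
  by rewrite horner_sum; apply: eq_bigr => i _; rewrite hornerM hornerC.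
rewrite evalM; transitivity (fps_mul r (fps_mul
    (fun i => (exp_gf h i).[x]) (fun i => (exp_gf h i).[y])) n).
  by apply: eq_bigr => i _; rewrite horner_exp_gfD.
rewrite fps_mulCA.
by apply: eq_bigr => i _; rewrite evalM.
Qed.

End Sheffer.

(** * Base-[b] digits and subtraction without borrows *)

Section Digits.
Local Open Scope nat_scope.
Variable b : nat.
Hypothesis b_gt1 : 1 < b.
Implicit Types (i j k m n N : nat).

Let b_gt0 : 0 < b. Proof. exact: ltnW. Qed.

Lemma digit0 n : digit b 0 n = n %% b.
Proof. by rewrite /digit expn0 divn1. Qed.

Lemma digitS i n : digit b i.+1 n = digit b i (n %/ b).
Proof. by rewrite /digit expnS divnMA. Qed.

Lemma ltn_digit i n : digit b i n < b.
Proof. exact: ltn_pmod. Qed.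

Lemma digit_small N i n : n < b ^ N -> N <= i -> digit b i n = 0.
Proof.
move=> lt_n le_Ni.
by rewrite /digit divn_small ?mod0n // (leq_trans lt_n) ?leq_exp2l.
Qed.

Lemma leq_digits k j : (forall i, digit b i k <= digit b i j) -> k <= j.
Proof.
elim/ltn_ind: k j => -[|k] // IHk j le_kj.
rewrite (divn_eq k.+1 b) (divn_eq j b) leq_add //.
  by rewrite leq_mul2r IHk ?orbT // ?ltn_Pdiv // => i; rewrite -!digitS.
by rewrite -!digit0.
Qed.

Lemma digitB k j : (forall i, digit b i k <= digit b i j) ->
  forall i, digit b i (j - k) = digit b i j - digit b i k.
Proof.
(* Without a borrow, quotients and remainders subtract separately; with [lt_r] below, this is the
   Euclidean division of [j - k] by [b]. *)
have divB m n : n %/ b <= m %/ b -> n %% b <= m %% b ->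
    m - n = (m %/ b - n %/ b) * b + (m %% b - n %% b).
  rewrite {3}(divn_eq m b) {3}(divn_eq n b) mulnBl => /leq_mul/(_ (leqnn b)).
  by move: (_ %/ _ * _) (_ %/ _ * _) (_ %% _) (_ %% _); lia.
move=> le_kj i; elim: i k j le_kj => [|i IHi] k j le_kj.
all: have lt_r : j %% b - k %% b < b
  by exact: leq_ltn_trans (leq_subr _ _) (ltn_pmod _ b_gt0).
all: have le_q l : digit b l (k %/ b) <= digit b l (j %/ b)
  by rewrite -!digitS.
all: rewrite (divB j k (leq_digits le_q)) -?digit0 //.
  by rewrite !digit0 modnMDl modn_small.
by rewrite !digit0 !digitS divnMDl // (divn_small lt_r) addn0 IHi.
Qed.

Definition digits N (n : 'I_(b ^ N)) : {ffun 'I_N -> 'I_b} :=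
  [ffun i : 'I_N => Ordinal (ltn_digit i n)].

(** Numbers with equal digits bound each other by [leq_digits], and both sides have [b ^ N]
    elements. *)
Lemma digits_bij N : bijective (@digits N).
Proof.
apply: inj_card_bij; last by rewrite card_ffun !card_ord.
move=> m n /ffunP eq_mn; apply/val_inj/eqP.
have eqd i : digit b i m = digit b i n.
  have [lt_iN | le_Ni] := ltnP i N; last by rewrite !(digit_small _ le_Ni).
  by have := congr1 val (eq_mn (Ordinal lt_iN)); rewrite !ffunE.
by rewrite eqn_leq; apply/andP; split; apply: leq_digits => i; rewrite eqd.
Qed.

End Digits.

(** * Digit matrices as Kronecker products of Toeplitz matrices *)

Section DigitMatrix.
Variables (K : fieldType) (b : nat).
Hypothesis b_gt1 : (1 < b)%N.
Implicit Types (s p : nat -> {poly K}).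

Lemma sum_prod_digits N (F : 'I_N -> nat -> K) :
  \sum_(m < b ^ N) \prod_(i < N) F i (digit b i m) =
  \prod_(i < N) \sum_(a < b) F i a.
Proof.
rewrite bigA_distr_bigA (reindex (@digits b b_gt1 N)) /=; last first.
  exact/onW_bij/digits_bij.
by apply: eq_bigr => m _; apply: eq_bigr => i _; rewrite ffunE.
Qed.

Definition toeplitz (u : fps K) (j k : nat) : K :=
  if (k <= j)%N then u (j - k)%N else 0.

(** Only [k <= a <= j] contributes, and [j < b] keeps this whole range inside the sum. *)
Lemma sum_toeplitz (u v : fps K) j k : (j < b)%N ->
  \sum_(a < b) toeplitz u j a * toeplitz v a k = toeplitz (fps_mul u v) j k.
Proof.
move=> lt_jb; rewrite /toeplitz; case: (leqP k j) => [le_kj | lt_jk]; last first.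
  rewrite big1 // => a _; case: leqP => [le_aj|]; last by rewrite mul0r.
  by rewrite leqNgt (leq_ltn_trans le_aj lt_jk) mulr0.
rewrite -(big_mkord xpredT (fun a => (if (a <= j)%N then u (j - a)%N else 0) *
                                     (if (k <= a)%N then v (a - k)%N else 0))).
rewrite (big_cat_nat (n := k)) ?(ltnW (leq_ltn_trans le_kj lt_jb)) //=.
rewrite [X in X + _]big_nat [X in X + _]big1 ?add0r; last first.
  by move=> a /andP[_ lt_ak]; rewrite [(k <= a)%N]leqNgt lt_ak mulr0.
rewrite (big_cat_nat (n := j.+1)) ?(leqW le_kj) //=.
rewrite [X in _ + X]big_nat [X in _ + X]big1 ?addr0; last first.
  by move=> a /andP[lt_ja _]; rewrite leqNgt lt_ja mul0r.
rewrite -[X in \sum_(X <= _ < _ | _) _ = _]add0n big_addn subSn // big_mkord.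
(* The convolution is indexed by the argument [j - a] of [u], hence the reversal. *)
rewrite /fps_mul (reindex_inj rev_ord_inj) /=.
apply: eq_bigr => -[a /=]; rewrite ltnS => le_a _; rewrite subSS.
rewrite leq_addl addnK ifT; last by lia.
by congr (u _ * _); lia.
Qed.

(** If the digit order fails, some Toeplitz factor is 0; if it holds, [k <= j] follows and the
    digits of [j - k] are the differences. *)
Lemma digit_mxE s N (x : 'rV[K]_N) (j k : 'I_(b ^ N)) :
  digit_mx s b x j k =
  \prod_(i < N) toeplitz (fun n => (divfact s n).[x 0 i])
                         (digit b i j) (digit b i k).
Proof.
rewrite mxE; case: (digit_leP k j b_gt1) => [le_kj | nle_kj].
  rewrite (leq_digits b_gt1 le_kj); apply: eq_bigr => i _.
  by rewrite /toeplitz le_kj (digitB b_gt1).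
rewrite andbF.
have [i lt_i] : exists i : 'I_N, (digit b i j < digit b i k)%N.
  (* The violating position lies below [N], because all digits of [k] from [N] on are 0. *)
  apply/existsP; apply: contra_notT nle_kj => /existsPn le_kj i.
  have [lt_iN | le_Ni] := ltnP i N; last by rewrite (digit_small b_gt1 _ le_Ni).
  by have := le_kj (Ordinal lt_iN); rewrite -leqNgt.
by rewrite (bigD1 i) //= /toeplitz leqNgt lt_i mul0r.
Qed.

(** The convolution identity is a hypothesis so that one argument serves both products, the second
    with [s] equal to [p]. *)
Lemma digit_mx_mul s p N (x y : 'rV[K]_N) :
    (forall n x y, (divfact s n).[x + y] =
       fps_mul (fun i => (divfact p i).[x]) (fun i => (divfact s i).[y]) n) ->
  digit_mx p b x *m digit_mx s b y = digit_mx s b (x + y).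
Proof.
move=> sD; apply/matrixP => j k; rewrite mxE digit_mxE.
under eq_bigr do rewrite !digit_mxE -big_split /=.
rewrite (sum_prod_digits (fun i a =>
  toeplitz (fun n => (divfact p n).[x 0 i]) (digit b i j) a *
  toeplitz (fun n => (divfact s n).[y 0 i]) a (digit b i k))).
apply: eq_bigr => i _; rewrite sum_toeplitz ?ltn_digit // /toeplitz.
by rewrite mxE sD.
Qed.

End DigitMatrix.

Theorem theorem2p4 (K : fieldType) (charK : [pchar K] =i pred0)
  (b N : nat) (hb : (2 <= b)%N)
  (f g fbar : fps K) (f0 : f 0%N = 0) (f1 : f 1%N != 0) (g0 : g 0%N != 0)
  (hfbar : fps_compinv f fbar)
  (s p : nat -> {poly K})
  (hs : sheffer_seq g fbar s) (hp : associated_seq fbar p)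
  (x y : 'rV[K]_N) :
  digit_mx p b x *m digit_mx s b y = digit_mx s b (x + y) /\
  digit_mx p b x *m digit_mx p b y = digit_mx p b (x + y).
Proof.
have [_ h0 _ _] := hfbar.
split; apply: digit_mx_mul => // n u v.
  (* Here [r] is the reciprocal of g(fbar(t)). *)
  rewrite -hs horner_sheffer_gfD //.
  by apply: eq_bigr => i _; rewrite hp hs.
rewrite -hp horner_exp_gfD //.
by apply: eq_bigr => i _; rewrite !hp.
Qed.
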